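(* Let $H$ be a strongly primary Puiseux monoid. 1. The following statements are equivalent. (a) $H$ is globally tame. (b) $\rho(H) < \infty$. (c) $(H : \widehat H) \neq \emptyset$. If these statements hold, then $\Lambda(H) = \infty$. 2. If $\Lambda(H) < \infty$, then $H$ is locally tame but not globally tame.
   Context: A Puiseux monoid is a submonoid $H$ of $(\mathbb Q_{\ge 0}, +)$. Let $H^\bullet = H\setminus\{0\}$; $\mathbb N$ is the set of positive integers. $H$ is strongly primary if $H \ne \{0\}$ and for each $a \in H^\bullet$ there is $n \in \mathbb N$ such that every sum of $n$ elements of $H^\bullet$ lies in $a+H$. (Strongly primary monoids are atomic.) Let $\mathsf q(H)\subset \mathbb Q$ be the quotient group of $H$, $\widehat H = \{x \in \mathsf q(H) : \text{there is } c \in H \text{ with } c+nx \in H \text{ for all } n \in \mathbb N\}$ the complete integral closure, and $(H : \widehat H) = \{x \in \mathsf q(H) : x + \widehat H \subset H\}$ the conductor. An atom of $H$ is an element of $H^\bullet$ that is not a sum of two elements of $H^\bullet$; $\mathcal A(H)$ is the set of atoms. A factorization of $a \in H$ is a finite multiset $z$ of atoms with sum $a$; $|z|$ is its cardinality with multiplicities; $\mathsf Z(a)$ is the set of factorizations of $a$, and $\mathsf L(a) = \{|z| : z \in \mathsf Z(a)\}$. For $z,z' \in \mathsf Z(a)$, removing the largest common sub-multiset leaves disjoint multisets of sizes $m$ and $n$, and $\mathsf d(z,z') = \max\{m,n\}$. For $u \in \mathcal A(H)$, the local tame degree $\mathsf t(H,u)$ is the smallest $N \in \mathbb N_0 \cup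 \{\infty\}$ such that: for each $a \in H$ having a factorization that contains $u$, and each $z \in \mathsf Z(a)$, there is $z' \in \mathsf Z(a)$ containing $u$ with $\mathsf d(z,z') \le N$. $H$ is locally tame if $\mathsf t(H,u) < \infty$ for all $u \in \mathcal A(H)$, and globally tame if $\sup\{\mathsf t(H,u) : u \in \mathcal A(H)\} < \infty$. The elasticity is $\rho(H) = \sup\{\rho(\mathsf L(a)) : a \in H\}$, where $\rho(L) = \sup L/\min L$ for non-empty $L \subset \mathbb N$ and $\rho(\{0\}) = 1$. Further, $\Lambda(H) = \sup\{\min \mathsf L(a) : a \in H\} \in \mathbb N_0 \cup \{\infty\}$. *)

(* Defs.v *)
From HB Require Import structures.
From mathcomp Require Import all_boot all_order all_algebra.
From mathcomp Require Import finmap multiset.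
From mathcomp Require Import boolp classical_sets reals constructive_ereal ereal.

Set Implicit Arguments.
Unset Strict Implicit.
Unset Printing Implicit Defensive.

Import Order.TTheory GRing.Theory Num.Theory.
Local Open Scope classical_set_scope.
Local Open Scope ring_scope.

Definition puiseux_monoid (H : set rat) : Prop :=
  [/\ H 0, forall x y, H x -> H y -> H (x + y) & forall x, H x -> 0 <= x].

Definition nonzero (H : set rat) : set rat := [set x | H x /\ x != 0].

Definition strongly_primary (H : set rat) : Prop :=
  H <> [set 0] /\
  forall a, nonzero H a ->
    exists2 n : nat, (0 < n)%N &
      forall x : 'I_n -> rat, (forall i, nonzero H (x i)) ->
        exists2 h, H h & \sum_(i < n) x i = a + h.

Definition quotient_group (H : set rat) : set rat :=
  [set x | exists a b, [/\ H a, H b & x = a - b]].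

Definition complete_integral_closure (H : set rat) : set rat :=
  [set x | quotient_group H x /\
    exists2 c, H c & forall n : nat, (0 < n)%N -> H (c + x *+ n)].

Definition conductor (H : set rat) : set rat :=
  [set x | quotient_group H x /\
    forall y, complete_integral_closure H y -> H (x + y)].

Definition atoms (H : set rat) : set rat :=
  [set u | nonzero H u /\
    forall x y, nonzero H x -> nonzero H y -> u <> x + y].

Definition factorizations (H : set rat) (a : rat) : set {mset rat}%mset :=
  [set z | (forall u, u \in z -> atoms H u) /\ \sum_(u <- z) u = a].

Definition lengths (H : set rat) (a : rat) : set nat :=
  [set size z | z in factorizations H a].

(* Multiset difference truncates multiplicities, so [z `\` z'] is [z] with the
   largest common sub-multiset of [z] and [z'] removed. *)
Definition fact_dist (z z' : {mset rat}%mset) : nat :=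
  maxn (size (z `\` z')%mset) (size (z' `\` z)%mset).

Definition tame_bound (H : set rat) (u : rat) (N : nat) : Prop :=
  forall a, H a -> (exists2 z0, factorizations H a z0 & u \in z0) ->
  forall z, factorizations H a z ->
    exists z', [/\ factorizations H a z', u \in z' & (fact_dist z z' <= N)%N].

Section ExtendedInvariants.
Variable R : realType.

Definition enat (n : nat) : \bar R := n%:R%:E.

(* For a nonempty set of naturals [enat_inf] is its minimum; it is [+oo] on the
   empty set. *)
Definition enat_inf (L : set nat) : \bar R := ereal_inf [set enat n | n in L].
Definition enat_sup (L : set nat) : \bar R := ereal_sup [set enat n | n in L].

Definition tame_degree (H : set rat) (u : rat) : \bar R :=
  enat_inf [set N | tame_bound H u N].

Definition locally_tame (H : set rat) : Prop :=
  forall u, atoms H u -> (tame_degree H u < +oo)%E.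

Definition globally_tame (H : set rat) : Prop :=
  (ereal_sup [set tame_degree H u | u in atoms H] < +oo)%E.

Definition set_elasticity (L : set nat) : \bar R :=
  if `[< L = [set 0%N] >] then 1%E else (enat_sup L / enat_inf L)%E.

Definition elasticity (H : set rat) : \bar R :=
  ereal_sup [set set_elasticity (lengths H a) | a in H].

Definition Lambda (H : set rat) : \bar R :=
  ereal_sup [set enat_inf (lengths H a) | a in H].

End ExtendedInvariants.

(* Main.v *)
(* The nonzero elements of [H] are bounded away from 0, say by [d], and both (b)
   and (c) amount to the atoms being bounded above, say by [M].
   (a) => (b): if every tame degree is at most [t], an atom dividing a sum of
   atoms divides a subsum of at most [t + 1] of them; cancelling the atoms of a
   factorization one by one gives [max L(a) <= (t + 1) min L(a)].
   (b) => bounded atoms: two atoms are commensurable, [m u = n v], so their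
   ratio is at most the elasticity.
   Bounded atoms => (c): fix [a] nonzero and [n] such that every sum of [n]
   nonzero elements lies in [a + H]. Any [h] in [H] with [h >= n M] has at least
   [n] atoms, so [h - a] is in [H]. If [x >= n M] is in the quotient group, some
   [x + k a] is in [H], and descending on [k] gives [x] in [H]. As the closure
   is the nonnegative part of the quotient group, the conductor is nonempty.
   (c) => (a): a sum of enough atoms, in a number independent of [u], exceeds
   [u] by more than a conductor element, so replacing at most that many atoms of
   a factorization makes [u] appear.
   For bounded atoms [min L(a) >= a / M], hence [Lambda] is infinite. If
   [Lambda] is finite, then for each [u] the replacement step goes through with
   the constant of strong primariness for [u] and a shortest factorization of
   the remaining part. *)
Require Import Defs.
From mathcomp Require Import all_boot all_order all_algebra.
From mathcomp Require Import finmap multiset lra zify.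
From mathcomp Require Import boolp classical_sets reals constructive_ereal ereal.

Set Implicit Arguments.
Unset Strict Implicit.
Unset Printing Implicit Defensive.

Import Order.TTheory GRing.Theory Num.Theory.
Local Open Scope classical_set_scope.
Local Open Scope ring_scope.

(** * Multisets and the distance of factorizations *)

Lemma big_msetD (K : choiceType) (V : nmodType) (A B : {mset K}%mset) (F : K -> V) :
  \sum_(u <- (A `+` B)%mset) F u = \sum_(u <- A) F u + \sum_(u <- B) F u.
Proof.
rewrite -big_cat; apply: perm_big; apply/allP => x _ /=.
by rewrite count_cat !count_mem_mset msetE2.
Qed.

Lemma size_msetD (K : choiceType) (A B : {mset K}%mset) :
  size (A `+` B)%mset = (size A + size B)%N.
Proof. by rewrite -!sum1_size; exact: big_msetD. Qed.

Lemma msetIB (K : choiceType) (A B : {mset K}%mset) :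
  (A `&` B `+` A `\` B)%mset = A.
Proof. by apply/msetP => x; rewrite !msetE2 /minn; case: ltnP; lia. Qed.

Lemma msubset_size (K : choiceType) (A B : {mset K}%mset) :
  (A `<=` B)%mset -> (size A <= size B)%N.
Proof. by move=> /msetBDKC <-; rewrite size_msetD leq_addr. Qed.

(** The common part [r] cancels in both truncated differences, leaving sub-multisets of [s] and of
    [t]. *)
Lemma fact_distDr (s t r : {mset rat}%mset) :
  (fact_dist (s `+` r)%mset (t `+` r)%mset <= maxn (size s) (size t))%N.
Proof.
rewrite /fact_dist !msetBDr geq_max !leq_max.
by apply/andP; split; apply/orP; [left|right]; exact/msubset_size/msubsetDl.
Qed.

(** * Rational numbers and sums over sequences *)

Lemma rat_archimedean (a b : rat) : 0 < a -> exists n, b < a *+ n.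
Proof.
move=> a0; exists (Num.bound (`|b| / a)); rewrite -mulr_natr mulrC -ltr_pdivrMr//.
apply: le_lt_trans (archi_boundP _); last by rewrite divr_ge0// ltW.
by rewrite ler_wpM2r ?ler_norm// invr_ge0 ltW.
Qed.

(** [m] and [n] are the denominator and the numerator of [a / b]. *)
Lemma rat_commensurable (a b : rat) : 0 <= a -> 0 < b ->
  exists m n, (0 < m)%N /\ a *+ m = b *+ n.
Proof.
move=> a0 b0; have : 0 <= numq (a / b) by rewrite numq_ge0 divr_ge0// ltW.
have := divq_num_den (a / b); have := denq_gt0 (a / b).
case: (denq _) (numq _) => [m|//] [n|//] m0 abE _; exists m, n; split=> //.
have m0' : m%:R != 0 :> rat by rewrite pnatr_eq0 -lt0n.
rewrite -(mulr_natr a) -(mulr_natl b); apply/eqP.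
by rewrite -(eqr_div _ _ (lt0r_neq0 b0) m0'); apply/eqP; rewrite -abE.
Qed.

Lemma sum_seq_ge (d : rat) (s : seq rat) :
  (forall u, u \in s -> d <= u) -> d *+ size s <= \sum_(u <- s) u.
Proof.
move=> sd; rewrite -iter_addr_0 -count_predT -big_const_seq.
by rewrite big_seq [leRHS]big_seq ler_sum.
Qed.

Lemma sum_seq_le (d : rat) (s : seq rat) :
  (forall u, u \in s -> u <= d) -> \sum_(u <- s) u <= d *+ size s.
Proof.
move=> sd; rewrite -iter_addr_0 -count_predT -big_const_seq.
by rewrite big_seq [leRHS]big_seq ler_sum.
Qed.

Lemma tame_boundW (H : set rat) u M N : (M <= N)%N ->
  tame_bound H u M -> tame_bound H u N.
Proof.
move=> MN MP a Ha az z /(MP a Ha az)[z' [z'P uz' dM]].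
by exists z'; split=> //; exact: leq_trans MN.
Qed.

Lemma lty_le_enat (R : realType) (x : \bar R) :
  (x < +oo)%E -> exists n, (x <= enat R n)%E.
Proof.
case: x => [x _|//|_]; last by exists 0%N; exact: leNye.
exists (Num.bound `|x|); rewrite lee_fin (le_trans (ler_norm x))//.
exact/ltW/archi_boundP.
Qed.

Lemma enat_inf_min (R : realType) (L : set nat) n : L n ->
  exists2 m, L m & (forall k, L k -> (m <= k)%N) /\ enat_inf R L = enat R m.
Proof.
move=> Ln; have exL : exists m, `[< L m >] by exists n; exact/asboolP.
have [m /asboolP Lm mP] := ex_minnP exL.
have {}mP k : L k -> (m <= k)%N by move=> /asboolP /mP.
exists m => //; split=> //; apply/eqP; rewrite eq_le; apply/andP; split.
  by apply: ereal_inf_lbound; exists m.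
by apply: le_ereal_inf_tmp => _ [k /mP mk <-]; rewrite lee_fin ler_nat.
Qed.

(** * Strongly primary monoids: lower bound and atomicity *)

Section StronglyPrimary.
Variable H : set rat.
Hypotheses (puiseuxH : puiseux_monoid H) (primaryH : strongly_primary H).

Lemma puiseux0 : H 0. Proof. by case: puiseuxH. Qed.

Lemma puiseuxD x y : H x -> H y -> H (x + y).
Proof. by case: puiseuxH => _ + _; apply. Qed.

Lemma puiseuxMn x n : H x -> H (x *+ n).
Proof.
move=> Hx; elim: n => [|n IHn]; first by rewrite mulr0n; exact: puiseux0.
by rewrite mulrS; exact: puiseuxD.
Qed.

Lemma puiseux_ge0 x : H x -> 0 <= x.
Proof. by case: puiseuxH => _ _; apply. Qed.

Lemma puiseux_sum (s : seq rat) :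
  (forall u, u \in s -> H u) -> H (\sum_(u <- s) u).
Proof.
move=> Hs; rewrite big_seq; apply: (big_ind H) => //.
- exact: puiseux0.
- exact: puiseuxD.
Qed.

Lemma nonzero_gt0 x : nonzero H x -> 0 < x.
Proof. by move=> [Hx x0]; rewrite lt0r x0 puiseux_ge0. Qed.

Lemma nonzero_ex : exists a, nonzero H a.
Proof.
apply: contrapT => noa; case: primaryH => + _; apply.
apply/seteqP; split=> x /=; last by move=> ->; exact: puiseux0.
by move=> Hx; apply: contrapT => /eqP x0; apply: noa; exists x.
Qed.

(** Strong primariness speaks of exactly [n] summands; in a longer sequence the surplus terms are
    absorbed into [h]. *)
Lemma sum_nonzero_divisible a : nonzero H a ->
  exists2 n : nat, (0 < n)%N & forall s : seq rat,
    (forall u, u \in s -> nonzero H u) -> (n <= size s)%N ->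
    exists2 h, H h & \sum_(u <- s) u = a + h.
Proof.
case: primaryH => _ /[apply] -[n n0 nP]; exists n => // s Hs ns.
have [i|h Hh hE] := nP (fun i => nth 0 s i).
  by apply/Hs/mem_nth/(leq_trans _ ns).
exists (h + \sum_(u <- drop n s) u).
  apply: puiseuxD => //; apply: puiseux_sum => u /mem_drop us.
  by case: (Hs _ us).
rewrite addrA -hE -[in LHS](cat_take_drop n s) big_cat/=; congr (_ + _).
rewrite (big_nth 0) size_takel// big_mkord; apply: eq_bigr => i _.
by rewrite nth_take.
Qed.

Lemma nonzero_lower_bound : exists2 d, 0 < d & forall x, nonzero H x -> d <= x.
Proof.
have [a Ha] := nonzero_ex.
have [n n0 nP] := sum_nonzero_divisible Ha.
have n0' : 0 < n%:R :> rat by rewrite ltr0n.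
exists (a / n%:R); first by rewrite divr_gt0// nonzero_gt0.
(* The sum of [n] copies of [x] lies in [a + H], so it is at least [a]. *)
move=> x Hx; have [u|| h Hh] := nP (nseq n x); rewrite ?size_nseq//.
  by rewrite mem_nseq => /andP[_ /eqP->].
rewrite big_nseq iter_addr_0 ler_pdivrMr// mulr_natr => ->.
by rewrite lerDl puiseux_ge0.
Qed.

Lemma factorization_seq (s : seq rat) a :
  (forall u, u \in s -> atoms H u) -> \sum_(u <- s) u = a ->
  factorizations H a (seq_mset s).
Proof.
move=> Hs <-; split; last exact/perm_big/perm_eq_seq_mset.
by move=> u; rewrite (perm_mem (perm_eq_seq_mset s)); exact: Hs.
Qed.

Lemma factorizationD a b s t : factorizations H a s -> factorizations H b t ->
  factorizations H (a + b) (s `+` t)%mset.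
Proof.
move=> [sA <-] [tA <-]; split; last by rewrite big_msetD.
by move=> u; rewrite in_msetD => /orP[/sA|/tA].
Qed.

Lemma factorization1 u : atoms H u -> factorizations H u [mset u]%mset.
Proof.
by move=> Au; split=> [v|]; [rewrite in_mset1 => /eqP-> | rewrite big_msetn].
Qed.

Lemma factorization_in a z : factorizations H a z -> H a.
Proof. by move=> [zA <-]; apply: puiseux_sum => u /zA[[]]. Qed.

Lemma factorization_ex a : H a -> exists z, factorizations H a z.
Proof.
have [d d0 dP] := nonzero_lower_bound.
(* Induction on [n] with [a < d *+ n]: a nonzero non-atom splits into two parts, each at least [d],
   so the other part is smaller than [a] by at least [d]. *)
have [n] := rat_archimedean a d0; elim: n a => [|n IHn] a an Ha.
  by move: (puiseux_ge0 Ha); rewrite leNgt an.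
have [->|a0] := eqVneq a 0.
  by exists mset0; split=> [u|]; rewrite ?in_mset0// big_mset0.
have [Aa|nAa] := pselect (atoms H a).
  by exists [mset a]%mset; exact: factorization1.
have [x [y [Hx Hy axy]]] : exists x y, [/\ nonzero H x, nonzero H y & a = x + y].
  apply: contrapT => nxy; apply: nAa; split=> // x y Hx Hy axy.
  by apply: nxy; exists x, y.
move: an (dP _ Hx) (dP _ Hy); rewrite axy mulrS => an xd yd.
have [|s sP] := IHn x _ Hx.1; first by lra.
have [|t tP] := IHn y _ Hy.1; first by lra.
by exists (s `+` t)%mset; exact: factorizationD.
Qed.

Lemma factorization0 z : factorizations H 0 z -> z = mset0.
Proof.
move=> [zA]; case: (mset_0Vmem z) => // -[u uz].
have u0 : 0 < u by apply/nonzero_gt0/(zA _ uz).1.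
rewrite -(msetB1K uz) big_msetD big_msetn => /eqP.
rewrite gt_eqF// ltr_pwDl// puiseux_ge0//; apply: puiseux_sum => v.
by move=> /(msubset_subset (msubsetDl _ _)) /zA [[]].
Qed.

Lemma mem_lengths a z : factorizations H a z -> lengths H a (size z).
Proof. by exists z. Qed.

(** An empty sum is 0, whose only factorization is empty. This keeps the divisor in [set_elasticity]
    positive. *)
Lemma lengths0 a : lengths H a 0%N -> lengths H a = [set 0%N].
Proof.
move=> [z [zA zE] /eqP]; rewrite size_mset_eq0 => /eqP z0.
rewrite -zE z0 big_mset0; apply/seteqP; split=> [_ [y yP <-]|_ ->] /=.
  by rewrite (factorization0 yP) size_mset0.
by exists mset0; rewrite ?size_mset0//; split=> [u|]; rewrite ?in_mset0 ?big_mset0.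
Qed.

Lemma atom_ex : exists u, atoms H u.
Proof.
have [a [Ha /eqP a0]] := nonzero_ex; have [z [zA zE]] := factorization_ex Ha.
case: (mset_0Vmem z) => [z0|[u uz]]; last by exists u; exact: zA.
by case: a0; rewrite -zE z0 big_mset0.
Qed.

Definition bounded_atoms := exists M : rat, forall u, atoms H u -> u <= M.

(** * Quotient group, complete integral closure and conductor *)

Lemma quotient_groupD x y :
  quotient_group H x -> quotient_group H y -> quotient_group H (x + y).
Proof.
move=> [a [b [Ha Hb ->]]] [c [d [Hc Hd ->]]]; exists (a + c), (b + d).
by split; [exact: puiseuxD.. | rewrite opprD addrACA].
Qed.

Lemma quotient_groupN x : quotient_group H x -> quotient_group H (- x).
Proof. by move=> [a [b [Ha Hb ->]]]; exists b, a; rewrite opprB. Qed.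

Lemma quotient_group_in x : H x -> quotient_group H x.
Proof. by exists x, 0; rewrite subr0; split=> //; exact: puiseux0. Qed.

(* Some positive multiple of [x = a - b] lies in [H], and [n b] absorbs the
   negative parts of the multiples [j x] with [j < n]. *)
Lemma complete_integral_closureE :
  complete_integral_closure H = [set x | quotient_group H x /\ 0 <= x].
Proof.
apply/seteqP; split=> x /= [qx].
  move=> [c Hc cP]; split=> //; rewrite leNgt; apply/negP => x0.
  have [|n] := @rat_archimedean (- x) c; first by rewrite oppr_gt0.
  rewrite mulNrn => cn.
  have /cP/puiseux_ge0 : (0 < n.+1)%N by [].
  by rewrite mulrS; lra.
move=> x0; split=> //; have [h Hh] := nonzero_ex.
have [n [m [n0 nm]]] := rat_commensurable x0 (nonzero_gt0 Hh).
have Hnx : H (x *+ n) by rewrite nm; apply: puiseuxMn; case: Hh.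
case: qx => a [b [Ha Hb xE]]; exists (b *+ n); first exact: puiseuxMn.
move=> k _; rewrite (divn_eq k n) mulrnDr mulnC mulrnA addrCA.
apply: puiseuxD; first exact: puiseuxMn.
have kn : (k %% n <= n)%N by rewrite ltnW// ltn_pmod.
rewrite xE mulrnBl addrCA -mulrnBr//.
by apply: puiseuxD; exact: puiseuxMn.
Qed.

Lemma bounded_atoms_conductor : bounded_atoms -> conductor H <> set0.
Proof.
move=> [M MP]; have [a Ha] := nonzero_ex; have [n n0 nP] := sum_nonzero_divisible Ha.
have sub_a h : H h -> M *+ n <= h -> H (h - a).
  move=> Hh hM; have [z [zA zE]] := factorization_ex Hh.
  have M0 : 0 < M.
    by have [u Au] := atom_ex; apply: lt_le_trans (MP _ Au); exact/nonzero_gt0/Au.1.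
  have nz : (n <= size z)%N.
    rewrite -(ler_pMn2l M0); apply: le_trans hM _.
    by rewrite -zE; apply: sum_seq_le => u /zA/MP.
  have [|h' Hh' zh] := nP z _ nz; first by move=> u /zA [].
  by rewrite -zE zh addrC addKr.
have in_H x : quotient_group H x -> M *+ n <= x -> H x.
  move=> [b [c [Hb Hc ->]]] xM.
  (* Sufficiently many copies of [a] sum to an element of [c + H], which absorbs [c]. *)
  have [k Hk] : exists k, H (b - c + a *+ k).
    have [c0|c0] := eqVneq c 0; first by exists 0%N; rewrite c0 subr0 addr0.
    have [k _ kP] := sum_nonzero_divisible (conj Hc c0 : nonzero H c).
    have [u||h Hh] := kP (nseq k a); rewrite ?size_nseq//.
      by rewrite mem_nseq => /andP[_ /eqP->].
    rewrite big_nseq iter_addr_0 => kE; exists k.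
    by rewrite kE addrA subrK; exact: puiseuxD.
  (* Every [b - c + a *+ k] is at least [M *+ n], so [sub_a] removes the copies of [a] one at a
     time. *)
  elim: k Hk => [|k IHk]; first by rewrite mulr0n addr0.
  rewrite mulrSr addrA => /sub_a; rewrite addrK => H'; apply/IHk/H'.
  by rewrite -(addrA (b - c)) -mulrSr (le_trans xM)// lerDl mulrn_wge0// ltW// nonzero_gt0.
have [m am] := rat_archimedean (M *+ n) (nonzero_gt0 Ha).
have qa : quotient_group H (a *+ m).
  by apply/quotient_group_in/puiseuxMn; case: Ha.
apply/eqP/set0P; exists (a *+ m); split=> // y.
rewrite complete_integral_closureE => -[qy y0]; apply: in_H.
  exact: quotient_groupD.
by rewrite (le_trans (ltW am))// lerDl.
Qed.

(** A larger atom [u] would split as [a + (u - a)]: [u - a - f] is a nonnegative element of the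
    quotient group, hence in the closure, so adding [f] puts [u - a] in [H]. *)
Lemma conductor_bounded_atoms : conductor H <> set0 -> bounded_atoms.
Proof.
move=> /eqP/set0P[f [qf fP]]; have [a Ha] := nonzero_ex.
exists (Num.max (f + a) a) => u [[Hu u0] uP]; rewrite leNgt gt_max; apply/negP.
move=> /andP[fa au]; apply: (uP a (u - a)); rewrite ?subrKC//.
split; last by rewrite subr_eq0 gt_eqF.
suff : H (f + (u - a - f)) by rewrite subrKC.
apply: fP; rewrite complete_integral_closureE; split; last by lra.
apply: quotient_groupD; last exact: quotient_groupN.
apply: quotient_groupD; first exact: quotient_group_in.
by apply/quotient_groupN/quotient_group_in; case: Ha.
Qed.



(** * Tame degrees and factorization lengths *)

Lemma tame_bound_split u n L : atoms H u ->
    (forall s : seq rat, (forall v, v \in s -> atoms H v) -> (n <= size s)%N ->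
      exists2 h, H h & \sum_(v <- s) v = u + h) ->
    (forall (s : seq rat) w, (forall v, v \in s -> atoms H v) ->
      (size s <= n)%N -> H w -> \sum_(v <- s) v = u + w ->
      exists2 y, factorizations H w y & (size y <= L)%N) ->
  tame_bound H u (maxn n L.+1).
Proof.
move=> Au nP LP a Ha [z0 [z0A z0E] uz0] z [zA zE].
have [w Hw aE] : exists2 w, H w & a = u + w.
  exists (\sum_(v <- (z0 `\ u)%mset) v).
    apply: puiseux_sum => v /(msubset_subset (msubsetDl _ _)) /z0A.
    by case=> -[].
  by rewrite -z0E -[in LHS](msetB1K uz0) big_msetD big_msetn.
have takeA v : v \in take n z -> atoms H v by move=> /mem_take /zA.
have [w' Hw' sE] : exists2 w', H w' & \sum_(v <- take n z) v = u + w'.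
  (* Either [n] atoms suffice, or the block is all of [z] and the given factorization containing [u]
     supplies the cofactor. *)
  have [nz|/ltnW zn] := leqP n (size z); first by apply: nP; rewrite ?size_takel.
  by exists w; rewrite // take_oversize// zE.
have sn : (size (take n z) <= n)%N by rewrite size_take_min geq_minl.
have [y yP yL] := LP _ _ takeA sn Hw' sE.
have zsr : z = (seq_mset (take n z) `+` seq_mset (drop n z))%mset.
  apply/msetP => v; rewrite msetE2 !mset_seqE -count_cat cat_take_drop.
  by rewrite count_mem_mset.
(* The block of at most [n] atoms is exchanged for [u] and [y]; the extra 1 in [L.+1] counts [u]. *)
exists ([mset u] `+` y `+` seq_mset (drop n z))%mset; split.
- have -> : a = u + w' + \sum_(v <- drop n z) v.
    by rewrite -sE -zE -big_cat cat_take_drop.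
  apply: factorizationD; first exact/factorizationD/yP/factorization1.
  by apply: factorization_seq => // v /mem_drop /zA.
- by rewrite !in_msetD mset11.
- rewrite {1}zsr; apply: leq_trans (fact_distDr _ _ _) _.
  rewrite (perm_size (perm_eq_seq_mset _)) size_msetD enum_msetn/= add1n.
  by rewrite geq_max !leq_max sn ltnS yL orbT.
Qed.

(** If [u] is missing from [z], some [z'] at distance at most [t] contains it, and cancelling the
    common part shows that [u] divides the sum of the rest of [z]. The bound [t.+1] leaves room for
    the block consisting of [u] alone when [t = 0]. *)
Lemma tame_bound_omega u t (z : {mset rat}%mset) w : tame_bound H u t ->
  atoms H u -> (forall v, v \in z -> atoms H v) -> H w ->
  \sum_(v <- z) v = u + w ->
  exists s r b, [/\ z = (s `+` r)%mset, (size s <= t.+1)%N, H b &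
    \sum_(v <- s) v = u + b].
Proof.
move=> tP Au zA Hw zE; have [uz|uz] := boolP (u \in z).
  exists [mset u]%mset, (z `\ u)%mset, 0; split.
  - by rewrite msetB1K.
  - by rewrite enum_msetn.
  - exact: puiseux0.
  - by rewrite big_msetn addr0.
have [y yP] := factorization_ex Hw.
have uy := factorizationD (factorization1 Au) yP.
have [||z' [[z'A z'E] uz' zz't]] := tP (u + w) _ _ z (conj zA zE).
- exact: factorization_in uy.
- by exists ([mset u] `+` y)%mset; rewrite // in_msetD mset11.
have uzz' : u \in (z' `\` z)%mset.
  by move: uz uz'; rewrite in_msetB !in_mset; case: (z u).
exists (z `\` z')%mset, (z `&` z')%mset, (\sum_(v <- (z' `\` z `\ u)%mset) v).
split.
- by rewrite msetDC msetIB.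
- by apply: leqW; apply: leq_trans zz't; exact: leq_maxl.
- apply: puiseux_sum => v /(msubset_subset (msubsetDl _ _)).
  by move=> /(msubset_subset (msubsetDl _ _)) /z'A [[]].
have -> : u + \sum_(v <- (z' `\` z `\ u)%mset) v = \sum_(v <- (z' `\` z)%mset) v.
  by rewrite -[in RHS](msetB1K uzz') big_msetD big_msetn.
apply: (addrI (\sum_(v <- (z `&` z')%mset) v)).
by rewrite -big_msetD msetIB zE -z'E msetIC -big_msetD msetIB.
Qed.

Lemma tame_bound_lengths t : (forall u, atoms H u -> tame_bound H u t) ->
  forall a m n, lengths H a m -> lengths H a n -> (n <= t.+1 * m)%N.
Proof.
move=> tP a _ _ [x [xA <-] <-] [z zP <-].
(* Induction on the factorization of length [m], as a sequence, with the other one arbitrary. *)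
elim: {x}(x : seq rat) xA z zP => [|u x IHx] xA z [zA].
  by rewrite big_nil => zE; rewrite (factorization0 (conj zA zE)) size_mset0.
have Au : atoms H u by apply: xA; rewrite mem_head.
have {}xA v : v \in x -> atoms H v by move=> vx; apply: xA; rewrite in_cons vx orbT.
have Hx : H (\sum_(v <- x) v) by apply: puiseux_sum => v /xA [[]].
rewrite big_cons => zE.
have [s [r [b [zsr st Hb sE]]]] := tame_bound_omega (tP _ Au) Au zA Hx zE.
have [y [yA yE]] := factorization_ex Hb.
(* Cancelling [u] costs at most the [t.+1] atoms of [s]: [r] survives and [y] only adds length. *)
have : factorizations H (\sum_(v <- x) v) (y `+` r)%mset.
  split=> [v|].
    by rewrite in_msetD => /orP[/yA//|vr]; apply: zA; rewrite zsr in_msetD vr orbT.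
  apply: (addrI u); rewrite -zE zsr !big_msetD sE yE addrA//.
move=> /(IHx xA); rewrite zsr !size_msetD/= mulnS => yr.
by rewrite leq_add// (leq_trans _ yr)// leq_addl.
Qed.

Lemma lengths_ratio_bounded_atoms k :
    (forall a m n, lengths H a m -> lengths H a n -> (n <= k * m)%N) ->
  bounded_atoms.
Proof.
have lenMn u n : atoms H u -> lengths H (u *+ n) n.
  move=> Au; exists (msetn n u); last by rewrite enum_msetn size_nseq.
  split=> [v|]; last by rewrite enum_msetn big_nseq iter_addr_0.
  by rewrite in_msetn => /andP[_ /eqP->].
move=> kP; have [v Av] := atom_ex; exists (v *+ k) => u Au.
have v0 : 0 < v by apply/nonzero_gt0/Av.1.
have [m [n [m0 mn]]] := rat_commensurable (puiseux_ge0 Au.1.1) v0.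
have /(kP _ _ _ (lenMn _ m Au)) nkm : lengths H (u *+ m) n.
  by rewrite mn; exact: lenMn.
by rewrite -(ler_pMn2r m0) mn -mulrnA ler_pMn2l.
Qed.

Lemma conductor_tame_bound : conductor H <> set0 ->
  exists t, forall u, atoms H u -> tame_bound H u t.
Proof.
move=> cH; have [M MP] := conductor_bounded_atoms cH.
have [f [qf fP]] : conductor H !=set0 by apply/set0P/eqP.
have [d d0 dP] := nonzero_lower_bound.
(* At least [n] atoms sum to more than [f + M], so removing [u] leaves more than [f]. What remains
   of at most [n] atoms is at most [M *+ n], so it has fewer than [L] atoms. *)
have [n nP] := rat_archimedean (f + M) d0.
have [L LP] := rat_archimedean (M *+ n) d0.
have sum_ge (s : seq rat) : (forall v, v \in s -> atoms H v) ->
    d *+ size s <= \sum_(v <- s) v.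
  by move=> sA; apply: sum_seq_ge => v /sA [/dP].
exists (maxn n L.+1) => u Au; apply: tame_bound_split => // [s sA ns|s w sA sn Hw sE].
  have Hs : H (\sum_(v <- s) v) by apply: puiseux_sum => v /sA [[]].
  exists (\sum_(v <- s) v - u); last by rewrite subrKC.
  suff : H (f + (\sum_(v <- s) v - u - f)) by rewrite subrKC.
  apply: fP; rewrite complete_integral_closureE; split.
    apply: quotient_groupD; last exact: quotient_groupN.
    apply: quotient_groupD; first exact: quotient_group_in.
    by apply/quotient_groupN/quotient_group_in; case: Au => -[].
  have := MP _ Au; have := sum_ge _ sA.
  have : d *+ n <= d *+ size s by rewrite ler_pMn2l.
  by lra.
have [y yP] := factorization_ex Hw; exists y => //; apply: ltnW.
rewrite -(ltr_pMn2l d0); apply: le_lt_trans LP; case: yP => yA yE.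
apply: le_trans (sum_ge _ yA) _; rewrite yE.
have M0 : 0 <= M by apply: le_trans (MP _ Au); apply/puiseux_ge0/Au.1.1.
have : \sum_(v <- s) v <= M *+ size s by apply: sum_seq_le => v /sA/MP.
have : M *+ size s <= M *+ n by apply: ler_wpMn2l.
have : 0 <= u by apply/puiseux_ge0/Au.1.1.
by rewrite sE; lra.
Qed.

(** With atoms at most [M], a multiple of an atom exceeding [M *+ L] needs more than [L] atoms. *)
Lemma bounded_atoms_lengths L : bounded_atoms ->
  exists2 a, H a & forall n, lengths H a n -> (L < n)%N.
Proof.
move=> [M MP]; have [u Au] := atom_ex.
have u0 : 0 < u by apply/nonzero_gt0/Au.1.
have M0 : 0 < M by apply: lt_le_trans (MP _ Au).
have [k kP] := rat_archimedean (M *+ L) u0.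
exists (u *+ k); first by apply: puiseuxMn; case: Au => -[].
move=> _ [z [zA zE] <-]; rewrite -(ltr_pMn2l M0).
apply: lt_le_trans kP _; rewrite -zE.
by apply: sum_seq_le => v /zA/MP.
Qed.

Lemma min_lengths_tame_bound L :
    (forall a, H a -> exists2 z, factorizations H a z & (size z <= L)%N) ->
  forall u, atoms H u -> exists N, tame_bound H u N.
Proof.
move=> LP u Au; have [n n0 nP] := sum_nonzero_divisible Au.1.
exists (maxn n L.+1); apply: tame_bound_split => // [s sA|s w _ _ /LP //].
by apply: nP => v /sA [].
Qed.

(** * Extended-real invariants as uniform natural bounds *)

Variable R : realType.

Lemma globally_tameP : globally_tame R H <->
  exists t, forall u, atoms H u -> tame_bound H u t.
Proof.
split=> [/lty_le_enat[t tP]|[t tP]].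
  exists t => u Au.
  (* A strict inequality is what extracts an actual bound [N < t.+1] from the infimum. *)
  have : (tame_degree R H u < enat R t.+1)%E.
    apply: (@le_lt_trans _ _ (enat R t)); last by rewrite lte_fin ltr_nat.
    by apply: le_trans tP; apply: ereal_sup_ubound; exists u.
  move=> /ereal_inf_lt[_ [N /= NP <-]]; rewrite lte_fin ltr_nat ltnS => Nt.
  exact: tame_boundW NP.
apply: (@le_lt_trans _ _ (enat R t)); last exact: ltry.
apply: ge_ereal_sup => _ [u /tP utP <-].
by apply: ereal_inf_lbound; exists t.
Qed.

Lemma locally_tame_bound :
  (forall u, atoms H u -> exists N, tame_bound H u N) -> locally_tame R H.
Proof.
move=> HP u /HP[N NP]; apply: (@le_lt_trans _ _ (enat R N)); last exact: ltry.
by apply: ereal_inf_lbound; exists N.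
Qed.

Lemma elasticityP : (elasticity R H < +oo)%E <->
  exists k, forall a m n, lengths H a m -> lengths H a n -> (n <= k * m)%N.
Proof.
split=> [/lty_le_enat[k kP]|[k kP]].
  exists k => a m n am an.
  have Ha : H a by case: am => z /factorization_in.
  have : (set_elasticity R (lengths H a) <= enat R k)%E.
    by apply: le_trans kP; apply: ereal_sup_ubound; exists a.
  rewrite /set_elasticity; case: asboolP => [a0 _|a0].
    by move: an; rewrite a0 => /= ->.
  have [m0 am0 [m0P ->]] := enat_inf_min R am.
  have m0_gt0 : (0 < m0)%N.
    by rewrite lt0n; apply/eqP => m00; apply/a0/lengths0; rewrite -m00.
  rewrite inver pnatr_eq0 gtn_eqF// lee_pdivrMr ?ltr0n// -EFinM -natrM => supP.
  have : (enat R n <= (k * m0)%:R%:E)%E.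
    by apply: le_trans supP; apply: ereal_sup_ubound; exists n.
  by rewrite lee_fin ler_nat => /leq_trans; apply; rewrite leq_mul2l m0P ?orbT.
(* [k.+1] is at least 1, so it also bounds the conventional value 1 at [a = 0]. *)
apply: (@le_lt_trans _ _ (enat R k.+1)); last exact: ltry.
apply: ge_ereal_sup => _ [a Ha <-]; rewrite /set_elasticity.
case: asboolP => [_|a0]; first by rewrite lee_fin ler1n.
have [z zP] := factorization_ex Ha.
have [m am [mP ->]] := enat_inf_min R (mem_lengths zP).
have m_gt0 : (0 < m)%N.
  by rewrite lt0n; apply/eqP => m0; apply/a0/lengths0; rewrite -m0.
rewrite inver pnatr_eq0 gtn_eqF// lee_pdivrMr ?ltr0n// -EFinM -natrM.
apply: ge_ereal_sup => _ [n an <-]; rewrite lee_fin ler_nat.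
by apply: leq_trans (kP _ _ _ am an) _; rewrite leq_mul2r leqnSn orbT.
Qed.

Lemma Lambda_lty : (Lambda R H < +oo)%E -> exists L, forall a, H a ->
  exists2 z, factorizations H a z & (size z <= L)%N.
Proof.
move=> /lty_le_enat[L LP]; exists L => a Ha; have [z zP] := factorization_ex Ha.
have [_ [y yP <-] [_ yE]] := enat_inf_min R (mem_lengths zP).
exists y => //; rewrite -(ler_nat R) -lee_fin -[(size y)%:R%:E]yE.
by apply: le_trans LP; apply: ereal_sup_ubound; exists a.
Qed.

End StronglyPrimary.

Theorem theorem3p9 (R : realType) (H : set rat)
    (puiseuxH : puiseux_monoid H) (primaryH : strongly_primary H) :
  ([<-> globally_tame R H;
        (elasticity R H < +oo)%E;
        conductor H <> set0]
   /\ (globally_tame R H -> Lambda R H = +oo%E))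
  /\ ((Lambda R H < +oo)%E -> locally_tame R H /\ ~ globally_tame R H).
Proof.
have tame_elast : globally_tame R H -> (elasticity R H < +oo)%E.
  move=> /globally_tameP[t tP]; apply/elasticityP => //; exists t.+1.
  exact: tame_bound_lengths.
have tame_Lambda : globally_tame R H -> ~ (Lambda R H < +oo)%E.
  move=> /tame_elast /elasticityP[]// k.
  move=> /(lengths_ratio_bounded_atoms puiseuxH primaryH) bH.
  move=> /Lambda_lty[]// L LP.
  have [a /LP[z zP zL] aL] := bounded_atoms_lengths puiseuxH primaryH L bH.
  by move: (aL _ (mem_lengths zP)); rewrite ltnNge zL.
split; [split|] => [|gH|LH].
(* With [tame_elast], the implications from (b) to (c) and from (c) to (a) close the cycle. *)
- split=> //; split=> [|cH].
    move=> /elasticityP[]// k.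
    move=> /(lengths_ratio_bounded_atoms puiseuxH primaryH).
    exact: bounded_atoms_conductor.
  by apply/globally_tameP/conductor_tame_bound.
- by apply/eqP; rewrite -leye_eq leNgt; apply/negP; exact: tame_Lambda.
- split; last by move=> /tame_Lambda.
  apply: locally_tame_bound; have [//|//|L LP] := Lambda_lty _ _ LH.
  exact: (min_lengths_tame_bound puiseuxH primaryH LP).
Qed.
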